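(* Let $G$ be a torsion group and assume that $G$ is a generalized $2$-Baer group. Then $G=H\times K$, where $H$ is a locally finite $p$-group which is a generalized $2$-Baer group, for some prime $p$, and $K$ is a $2$-Baer group without elements of order $p$.
   Context: A subgroup $H$ of a group $G$ is $2$-subnormal in $G$, written $H\lhd_2 G$, if there is a subgroup $H_1$ with $H\lhd H_1\lhd G$ (repetitions $H=H_1$ or $H_1=G$ are allowed). A group is a $2$-Baer group if all of its cyclic subgroups are $2$-subnormal. For a group $G$, $T_2(G)$ denotes the subgroup generated by all $x\in G$ such that $\langle x\rangle$ is not $2$-subnormal in $G$, with $T_2(G)=1$ if there are no such $x$. $G$ is a generalized $2$-Baer group if $T_2(G)\neq G$. *)

(* Defs.v *)
From HB Require Import structures.
From mathcomp Require Import all_boot.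
From mathcomp Require Import mathcomp_extra boolp classical_sets cardinality.

Set Implicit Arguments.
Unset Strict Implicit.
Unset Printing Implicit Defensive.

Local Open Scope group_scope.
Local Open Scope classical_set_scope.

(* A group is a subgroup G of an ambient, possibly infinite, [groupType];
   every notion below is relative to such a subset G, so that it applies both
   to the whole group [set: gT] and to its subgroups. *)

Section GroupNotions.

Variable gT : groupType.
Implicit Types (x y g : gT) (S H K G : set gT) (p n : nat).

Definition subgroup H : Prop := group_closed [in H].

Definition gen S : set gT := smallest subgroup S.

Definition cyc x : set gT := gen [set x].

(* G itself is meant to be a subgroup; this is not part of the definition. *)
Definition normal_in H G : Prop :=
  [/\ subgroup H, H `<=` G & forall x g, H x -> G g -> H (x ^ g)].

Definition subnormal2 H G : Prop :=
  exists H1, normal_in H H1 /\ normal_in H1 G.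

Definition Baer2 G : Prop := forall x, G x -> subnormal2 (cyc x) G.

(* If no cyclic subgroup fails to be 2-subnormal, this is gen set0 = 1. *)
Definition T2 G : set gT := gen [set x | G x /\ ~ subnormal2 (cyc x) G].

Definition gen_Baer2 G : Prop := T2 G <> G.

Definition has_order x n : Prop :=
  [/\ (0 < n)%N, x ^+ n = 1 & forall m, (0 < m < n)%N -> x ^+ m <> 1].

Definition torsion G : Prop := forall x, G x -> exists n, has_order x n.

Definition p_group p G : Prop :=
  forall x, G x -> exists k, has_order x (p ^ k)%N.

Definition locally_finite G : Prop :=
  forall S, S `<=` G -> finite_set S -> finite_set (gen S).

(* G is the internal direct product H x K. *)
Definition direct_product H K G : Prop :=
  [/\ normal_in H G, normal_in K G, H `&` K = [set 1]
    & [set h * k | h in H & k in K] = G].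

End GroupNotions.

(* Main.v *)
Require Import Defs.
From mathcomp Require Import all_boot.
From mathcomp Require Import boolp classical_sets cardinality.
Local Open Scope classical_set_scope.

(** Call an element good if the cyclic subgroup it generates is 2-subnormal in
    G, and for a set pi of primes let R_pi be the union of all normal locally
    finite pi-subgroups of G.

    A product of two such normal subgroups is again one ([normal_lf_setM]), so
    R_pi is itself a normal locally finite pi-subgroup.  As it is invariant
    under conjugation, the radical of a normal subgroup lies in the radical of
    G ([radical_sub]).  Applied to a chain <x> <| D <| G, where <x> is finite,
    this shows that every good pi-element lies in R_pi
    ([subnormal2_radical]).

    Every element outside T = T_2(G) is good, and powers of a good element are
    good ([subnormal2_cycX]).  Since G is a torsion group and T is a proper
    subgroup, some primary component of an element outside T is itself outside
    T ([prime_elt_notin]): this gives a prime p and a p-element y outside T,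
    which lies in H = R_p.  Put K = R_{p'}; then H and K meet trivially.

    Every x in G is a product h b with h in H and b a good element of K.  If x
    is outside T, split it into its p-part and its p'-part.  If x is in T, then
    y x is outside T, and multiplying its decomposition by y^-1 on the left
    changes only the factor in H.  Hence G = H x K.  For x in K the factor
    h = x b^-1 lies in H and in K, so x = b is good, and K is a 2-Baer group.
    Finally T_2(H) is contained in T, which misses y, so T_2(H) <> H. *)

Section GenBaer2.
Set Implicit Arguments.
Unset Strict Implicit.
Local Open Scope group_scope.
Variable gT : groupType.
Implicit Types (x y g : gT) (A B D S H K G : set gT) (p n : nat).

(** * Subgroups and conjugation *)

Lemma subgroupP H :
  subgroup H <-> H 1 /\ forall x y, H x -> H y -> H (x * y^-1).
Proof.
split=> [[H1 HV]|[H1 HV]].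
  split=> [|x y Hx Hy]; first by move: H1; rewrite inE.
  by have:= HV x y; rewrite !inE; apply.
by split=> [|x y]; rewrite !inE //; apply: HV.
Qed.

Lemma subgroup1 H : subgroup H -> H 1.
Proof. by case/subgroupP. Qed.

Lemma subgroupV H x : subgroup H -> H x -> H x^-1.
Proof. by case/subgroupP=> H1 HV /(HV _ _ H1); rewrite mul1g. Qed.

Lemma subgroupM H x y : subgroup H -> H x -> H y -> H (x * y).
Proof.
move=> sH Hx /(subgroupV sH) Hy.
by case/subgroupP: sH => _ HV; rewrite -[y]invgK; apply: HV.
Qed.

Lemma subgroupX H x n : subgroup H -> H x -> H (x ^+ n).
Proof.
move=> sH Hx; elim: n => [|n IHn]; first by rewrite expg0; apply: subgroup1.
by rewrite expgS; apply: subgroupM.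
Qed.

Lemma subgroupJ H x y : subgroup H -> H x -> H y -> H (x ^ y).
Proof.
move=> sH Hx Hy; rewrite conjgE.
by apply: (subgroupM sH); [apply: subgroupV | apply: subgroupM].
Qed.

Lemma subgroupI H K : subgroup H -> subgroup K -> subgroup (H `&` K).
Proof.
move=> /subgroupP[H1 HV] /subgroupP[K1 KV]; apply/subgroupP.
by split=> // x y [Hx Kx] [Hy Ky]; split; [apply: HV | apply: KV].
Qed.

Lemma subgroupT : subgroup [set: gT].
Proof. exact/subgroupP. Qed.

Lemma subgroup_conj H g : subgroup H -> subgroup [set x | H (x ^ g)].
Proof.
move=> /subgroupP[H1 HV]; apply/subgroupP; split=> [|x y] /=.
  by rewrite conj1g.
by rewrite conjMg conjVg; apply: HV.
Qed.

Lemma gen_subgroup S : subgroup (gen S).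
Proof.
apply/subgroupP; split=> [A [/subgroup1]//|x y Sx Sy A AP].
by case: (AP) => /subgroupP[_ AV] _; apply: AV; [apply: Sx | apply: Sy].
Qed.

Lemma sub_gen S x : S x -> gen S x.
Proof. by move=> Sx; apply: sub_gen_smallest. Qed.

Lemma gen_conj S g : (forall x, S x -> S (x ^ g)) ->
  forall x, gen S x -> gen S (x ^ g).
Proof.
move=> Sg; apply: (@smallest_sub _ (@subgroup gT) _ [set x | gen S (x ^ g)]).
  exact: subgroup_conj (gen_subgroup S).
by move=> x Sx; apply: sub_gen; apply: Sg.
Qed.

Lemma normal_restrict H K D : subgroup D ->
  normal_in H K -> normal_in (H `&` D) (K `&` D).
Proof.
move=> sD [sH HK nH]; split; first exact: subgroupI.
  by move=> x [Hx Dx]; split=> //; apply: HK.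
by move=> x g [Hx Dx] [Kg Dg]; split; [apply: nH | apply: subgroupJ].
Qed.

Lemma subnormal2_restrict H D : subgroup D -> H `<=` D ->
  subnormal2 H [set: gT] -> subnormal2 H D.
Proof.
move=> sD HD [K [nHK nK]]; exists (K `&` D); split.
  by rewrite -(setIidl HD); apply: normal_restrict.
by rewrite -{2}(setTI D); apply: normal_restrict.
Qed.

(** * Cyclic subgroups generated by elements of finite order *)

Lemma cycE x n : (0 < n)%N -> x ^+ n = 1 -> cyc x = range (fun k => x ^+ k).
Proof.
move=> n0 xn; apply/seteqP; split=> [|_ [k _ <-]]; last first.
  by apply: (subgroupX _ (gen_subgroup _)); apply: sub_gen.
apply: smallest_sub => [|_ ->]; last by exists 1%N; rewrite ?expg1.
apply/subgroupP; split=> [|_ _ [i _ <-] [j _ <-]].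
  by exists 0%N; rewrite ?expg0.
exists (i + j * n.-1)%N => //; rewrite expgnDr; congr (_ * _).
apply/esym/mulg1_eq; rewrite -expgnDr -mulnS prednK //.
by rewrite mulnC expgnA xn expg1n.
Qed.

Lemma finite_cyc x n : (0 < n)%N -> x ^+ n = 1 -> finite_set (cyc x).
Proof.
move=> n0 xn; rewrite (cycE n0 xn).
apply: (sub_finite_set (B := (fun k => x ^+ k) @` `I_n)); last first.
  exact/finite_image/finite_II.
move=> _ [k _ <-]; exists (k %% n)%N; first exact: ltn_pmod.
by rewrite {2}(divn_eq k n) expgnDr mulnC expgnA xn expg1n mul1g.
Qed.

(** Every subgroup of a finite cyclic group is characteristic in it: the
    subgroup [H] above [cyc x] serves for [cyc (x ^+ k)] as well. *)
Lemma subnormal2_cycX x n k G : (0 < n)%N -> x ^+ n = 1 ->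
  subnormal2 (cyc x) G -> subnormal2 (cyc (x ^+ k)) G.
Proof.
move=> n0 xn [H [[_ cH nc] nH]]; exists H; split=> //; case: (nH) => sH _ _.
have Hxk : H (x ^+ k) by apply: subgroupX => //; apply: cH; apply: sub_gen.
have xkn : (x ^+ k) ^+ n = 1 by rewrite expgnAC xn expg1n.
split; first exact: gen_subgroup.
  by apply: smallest_sub => // _ ->.
move=> y g; rewrite (cycE n0 xkn) => -[j _ <-] Hg.
have: cyc x (x ^ g) by apply: nc => //; apply: sub_gen.
rewrite (cycE n0 xn) => -[i _ xg].
by exists (i * j)%N; rewrite // !conjXg -xg expgnA [in RHS](expgnAC _ i k).
Qed.

(** * Elements whose order is a product of primes in a given set *)

Definition pi_group (pi : nat_pred) H :=
  forall x, H x -> exists2 n, pi.-nat n & x ^+ n = 1.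

(** Bezout: [x ^+ (i * m)] and [x ^+ (j * n)] are trivial, and the exponents
    can be chosen to differ by one. *)
Lemma coprime_exp1 m n x : (0 < m)%N -> coprime m n ->
  x ^+ m = 1 -> x ^+ n = 1 -> x = 1.
Proof.
move=> m0 co xm xn; case: (egcdnP n m0) => i j def_i _.
rewrite -[x]mulg1 -[in LHS](expg1n _ j) -[in LHS]xn.
have <- : x ^+ (i * m) = 1 by rewrite mulnC expgnA xm expg1n.
by rewrite def_i (eqP co) addn1 expgS mulnC expgnA.
Qed.

Lemma pi_expr1 (pi : nat_pred) m n x : pi.-nat m -> pi^'.-nat n ->
  x ^+ m = 1 -> x ^+ n = 1 -> x = 1.
Proof.
move=> pim pin; apply: coprime_exp1; first by case/andP: pim.
exact: pnat_coprime pim pin.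
Qed.

(** The two exponents are the idempotents of Z/n given by the Chinese remainder
    theorem for the coprime factors of [n]. *)
Lemma pi_decomp (pi : nat_pred) x n : (0 < n)%N -> x ^+ n = 1 ->
  exists i j, [/\ x = x ^+ i * x ^+ j,
    (x ^+ i) ^+ (n`_pi)%N = 1 & (x ^+ j) ^+ (n`_pi^')%N = 1].
Proof.
move=> n0 xn; set a := (n`_pi)%N; set b := (n`_pi^')%N.
have ab : (a * b)%N = n by apply: partnC.
have co : coprime a b by apply: coprime_partC.
have xmod k l : k = l %[mod n] -> x ^+ k = x ^+ l.
  move=> kl; rewrite (divn_eq k n) (divn_eq l n) kl !expgnDr.
  by rewrite ![(_ * n)%N]mulnC !expgnA xn !expg1n.
exists (chinese a b 1 0), (chinese a b 0 1); split.
- rewrite -expgnDr -[LHS]expg1; apply: xmod; apply/eqP.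
  rewrite -ab chinese_remainder //; apply/andP; split.
    by rewrite -modnDm !chinese_modl // modnDm.
  by rewrite -modnDm !chinese_modr // modnDm.
- rewrite -expgnA -(expg0 x); apply: xmod; apply/eqP.
  rewrite mod0n -[_ == _]/(dvdn _ _) -ab [X in (_ %| X)%N]mulnC
    dvdn_pmul2l ?part_gt0 //.
  by rewrite /dvdn chinese_modr // mod0n.
- rewrite -expgnA -(expg0 x); apply: xmod; apply/eqP.
  rewrite mod0n -[_ == _]/(dvdn _ _) -ab dvdn_pmul2r ?part_gt0 //.
  by rewrite /dvdn chinese_modl // mod0n.
Qed.

(** Links the exponents used by [pi_group] to the exact orders of [has_order]:
    the least positive exponent of [x] divides every other one. *)
Lemma pi_has_order (pi : nat_pred) x n : pi.-nat n -> x ^+ n = 1 ->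
  exists2 m, pi.-nat m & has_order x m.
Proof.
move=> pin xn.
have ex : exists m, (0 < m)%N && `[< x ^+ m = 1 >].
  by exists n; case/andP: pin => -> _; apply/asboolP.
case: (ex_minnP ex) => m /andP[m0 /asboolP xm] min_m.
have ordm : has_order x m.
  split=> // k /andP[k0 km] xk; have:= min_m k.
  by rewrite k0 leqNgt km => /(_ (asboolT xk)).
exists m => //; apply: pnat_dvd pin.
have xr : x ^+ (n %% m) = 1.
  by move: xn; rewrite {1}(divn_eq n m) expgnDr mulnC expgnA xm expg1n mul1g.
rewrite /dvdn; case: (posnP (n %% m)%N) => // r0.
have:= min_m (n %% m)%N; rewrite r0 leqNgt ltn_pmod //.
by move=> /(_ (asboolT xr)).
Qed.

(** * Products of a subgroup by a subgroup normalizing it *)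

Definition setM A B : set gT := [set a * b | a in A & b in B].
Definition normalizes B A := forall a b, A a -> B b -> A (a ^ b).

Lemma subgroup_setM A B : subgroup A -> subgroup B -> normalizes B A ->
  subgroup (setM A B).
Proof.
move=> sA sB nAB; apply/subgroupP; split.
  exists 1; first exact: subgroup1.
  by exists 1; [apply: subgroup1 | rewrite mul1g].
move=> _ _ [a Aa [b Bb <-]] [c Ac [d Bd <-]].
have Bbd : B (b * d^-1) by apply: subgroupM => //; apply: subgroupV.
exists (a * c^-1 ^ (b * d^-1)^-1).
  by apply: subgroupM => //; apply: nAB; apply: subgroupV.
exists (b * d^-1) => //.
by rewrite -mulgA -conjgCV invgM !mulgA.
Qed.

(** If [b ^+ n = 1] then [(a * b) ^+ n] lies in [A], as can be read off modulo
    [A]; so its order is a [pi]-number times a divisor of [n]. *)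
Lemma pi_group_setM pi A B : subgroup A -> subgroup B -> normalizes B A ->
  pi_group pi A -> pi_group pi B -> pi_group pi (setM A B).
Proof.
move=> sA sB nAB piA piB _ [a Aa [b Bb <-]].
have [n pin bn] := piB b Bb.
have [c Ac abn] : exists2 c, A c & (a * b) ^+ n = c * b ^+ n.
  elim: (n) => [|k [c Ac IHk]].
    by exists 1; rewrite ?mul1g ?expg0 //; apply: subgroup1.
  exists (a * c ^ b^-1).
    by apply: subgroupM => //; apply: nAB => //; apply: subgroupV.
  by rewrite !expgS IHk mulgA -[a * b * c]mulgA (conjgCV b c) !mulgA.
have [m pim cm] := piA c Ac.
by exists (n * m)%N; rewrite ?pnatM ?pin // expgnA abn bn mulg1.
Qed.

(** Write the finitely many elements of [S] as [a * b], let [R] be the finite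
    subgroup of [B] generated by the factors [b], and let [X] be the finite set
    of all [R]-conjugates of the factors [a].  Then [gen X] is finite because
    [A] is locally finite, and [R] normalizes it because [R] permutes [X].
    Hence [gen X * R] is a finite subgroup containing [S]. *)
Lemma locally_finite_setM A B : subgroup A -> subgroup B -> normalizes B A ->
  locally_finite A -> locally_finite B -> locally_finite (setM A B).
Proof.
move=> sA sB nAB lfA lfB S SAB finS.
have [f fP] : {f : gT -> gT * gT & forall s, S s ->
    [/\ A (f s).1, B (f s).2 & s = (f s).1 * (f s).2]}.
  apply: (@choice _ _ (fun s f => S s -> [/\ A f.1, B f.2 & s = f.1 * f.2])).
  move=> s; have [/SAB[a Aa [b Bb <-]]|nSs] := pselect (S s).
    by exists (a, b).
  by exists (1, 1).
pose R := gen ((snd \o f) @` S).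
have sR : subgroup R by apply: gen_subgroup.
have RB : R `<=` B by apply: smallest_sub => // _ [s /fP[_ ? _] <-].
have finR : finite_set R.
  apply: lfB; last exact: finite_image.
  by move=> _ [s /fP[_ ? _] <-].
pose X := [set (f s).1 ^ r | s in S & r in R].
have finX : finite_set (gen X).
  apply: lfA; last exact: finite_image2.
  by move=> _ [s /fP[? _ _] [r /RB Br <-]]; apply: nAB.
have nXR : normalizes R (gen X).
  move=> a r Xa Rr; apply: gen_conj Xa => _ [s Ss [t Rt <-]].
  by exists s => //; exists (t * r); [exact: (subgroupM sR) | rewrite conjgM].
apply: (sub_finite_set (B := setM (gen X) R)); last exact: finite_image2.
apply: smallest_sub.
  by apply: subgroup_setM nXR => //; apply: gen_subgroup.
move=> s Ss; have [_ _ ->] := fP s Ss.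
exists (f s).1; last by exists (f s).2 => //; apply: sub_gen; exists s.
apply: sub_gen; exists s => //.
by exists 1; [apply: subgroup1 | rewrite conjg1].
Qed.

(** * The locally finite pi-radical *)

Definition normal_lf (pi : nat_pred) A D :=
  [/\ normal_in A D, locally_finite A & pi_group pi A].

Lemma normal_lf1 pi D : subgroup D -> normal_lf pi [set 1] D.
Proof.
move=> sD; have s1 : subgroup [set (1 : gT)].
  by apply/subgroupP; split=> // x y -> ->; rewrite mulgV.
split; last by move=> _ ->; exists 1%N; rewrite ?expg1.
  split=> // [_ -> | _ g -> _]; first exact: subgroup1.
  by rewrite /= conj1g.
move=> S S1 _; apply: (sub_finite_set (B := [set 1])) => //.
exact: smallest_sub.
Qed.

Lemma normal_lf_setM pi A B D : subgroup D ->
  normal_lf pi A D -> normal_lf pi B D -> normal_lf pi (setM A B) D.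
Proof.
move=> sD [[sA AD nA] lfA piA] [[sB BD nB] lfB piB].
have nAB : normalizes B A by move=> a b Aa /BD; apply: nA.
split; [|exact: locally_finite_setM|exact: pi_group_setM].
split; first exact: subgroup_setM.
  by move=> _ [a /AD Da [b /BD Db <-]]; apply: subgroupM.
move=> _ g [a Aa [b Bb <-]] Dg; rewrite conjMg.
by exists (a ^ g); [apply: nA | exists (b ^ g); first apply: nB].
Qed.

Lemma normal_lf_conj pi A D G g : subgroup G -> normal_in D G -> G g ->
  normal_lf pi A D -> normal_lf pi [set x | A (x ^ g)] D.
Proof.
move=> sG [sD DG nD] Gg [[sA AD nA] lfA piA].
split; last first.
- move=> x /piA[n pin]; rewrite -conjXg => /eqP; rewrite conjg_eq1 => /eqP xn.
  by exists n.
- move=> S SA finS.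
  apply: (sub_finite_set (B := conjg^~ g^-1 @` gen (conjg^~ g @` S))).
    apply: smallest_sub => [|s Ss]; last first.
      by exists (s ^ g); rewrite ?conjgK //; apply: sub_gen; exists s.
    have /subgroupP[X1 XV] := gen_subgroup (conjg^~ g @` S).
    apply/subgroupP; split; first by exists 1; rewrite ?conj1g.
    move=> _ _ [x Xx <-] [y Xy <-]; exists (x * y^-1); first exact: XV.
    by rewrite conjMg conjVg.
  apply/finite_image/lfA; last exact: finite_image.
  by move=> _ [s /SA As <-].
split; first exact: subgroup_conj.
  by move=> x /AD Dx; rewrite -(conjgK g x); apply: nD => //; apply: subgroupV.
by move=> x h Ax Dh; rewrite /= conjJg; apply: nA => //; apply: nD.
Qed.

(** This variant of the Hirsch-Plotkin radical replaces local nilpotence by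
    being a locally finite [pi]-group.  A plain union is already a subgroup
    because the family is directed, by [normal_lf_setM]. *)
Definition radical (pi : nat_pred) D : set gT :=
  [set x | exists2 A, normal_lf pi A D & A x].

Lemma radical_subgroup pi D : subgroup D -> subgroup (radical pi D).
Proof.
move=> sD; apply/subgroupP; split.
  by exists [set 1] => //; apply: normal_lf1.
move=> x y [A nA Ax] [B nB By].
exists (setM A B); first exact: normal_lf_setM.
exists x => //; exists y^-1 => //.
by case: nB => -[sB _ _] _ _; apply: subgroupV.
Qed.

Lemma radical_pi pi D : pi_group pi (radical pi D).
Proof. by move=> x [A [_ _ piA] /piA]. Qed.

(** By directedness, a finite subset of the radical already lies in a single
    member of the defining family. *)
Lemma radical_locally_finite pi D : subgroup D -> locally_finite (radical pi D).
Proof.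
move=> sD S SR /finite_seqP[s defS]; rewrite {}defS in SR *.
suff [A [_ lfA _] sA] : exists2 A, normal_lf pi A D & [set` s] `<=` A.
  by apply: lfA => //; apply: finite_seq.
elim: s SR => [|x s IHs] SR; first by exists [set 1]; first apply: normal_lf1.
have [|A nA sA] := IHs.
  by move=> y /= ys; apply: SR; rewrite /= inE ys orbT.
have [|B nB Bx] := SR x; first by rewrite /= inE eqxx.
exists (setM A B); first exact: normal_lf_setM.
case: nA nB => -[/subgroup1 A1 _ _] _ _ [[/subgroup1 B1 _ _] _ _].
move=> y; rewrite /= inE => /orP[/eqP->|/sA Ay].
  by exists 1 => //; exists x; rewrite ?mul1g.
by exists y => //; exists 1; rewrite ?mulg1.
Qed.

(** Conjugation by an element of [G] permutes the normal locally finite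
    [pi]-subgroups of [D]. *)
Lemma radical_normal pi D G : subgroup G -> normal_in D G ->
  normal_in (radical pi D) G.
Proof.
move=> sG nDG; have [sD DG _] := nDG; split; first exact: radical_subgroup.
  by move=> x [A [[_ AD _] _ _] /AD/DG].
move=> x g [A nA Ax] Gg; exists [set y | A (y ^ g^-1)].
  by apply: normal_lf_conj nA; [exact: sG | exact: nDG | exact: subgroupV].
by rewrite /= conjgK.
Qed.

(** The radical of [D] is itself a normal locally finite [pi]-subgroup of
    [G]. *)
Lemma radical_sub pi D G : subgroup G -> normal_in D G ->
  radical pi D `<=` radical pi G.
Proof.
move=> sG nDG x Rx; exists (radical pi D) => //; case: (nDG) => sD _ _.
split; [exact: radical_normal|exact: radical_locally_finite|exact: radical_pi].
Qed.

(** In a chain <x> <| D <| G, the finite pi-group <x> is one of the subgroups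
    making up the radical of D, which lies in the radical of G. *)
Lemma subnormal2_radical pi x n : pi.-nat n -> x ^+ n = 1 ->
  subnormal2 (cyc x) [set: gT] -> radical pi [set: gT] x.
Proof.
move=> pin xn [D [nxD nD]]; apply: (radical_sub subgroupT nD).
have n0 : (0 < n)%N by case/andP: pin.
exists (cyc x); last exact: sub_gen.
split=> // [S Sx _|y].
  apply: (sub_finite_set _ (finite_cyc n0 xn)).
  by apply: smallest_sub => //; apply: gen_subgroup.
rewrite (cycE n0 xn) => -[k _ <-]; exists n => //.
by rewrite expgnAC xn expg1n.
Qed.

(** * Elements outside a proper subgroup, and the decomposition of G *)

Lemma not_T2_subnormal2 x : ~ T2 [set: gT] x -> subnormal2 (cyc x) [set: gT].
Proof. by move=> nTx; apply: contrapT => nx; apply: nTx; apply: sub_gen. Qed.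

(** An element is the product of its primary components, so they cannot all lie
    in a subgroup that misses it; the components are split off one prime at a
    time. *)
Lemma prime_elt_notin H x n : subgroup H -> (0 < n)%N -> x ^+ n = 1 -> ~ H x ->
  exists p y k, [/\ prime p, p.-nat k, y ^+ k = 1 & ~ H y].
Proof.
move=> sH; elim/ltn_ind: n x => n IHn x n0 xn nHx.
have [n1|n1] := leqP n 1.
  have n_1 : n = 1%N by apply/eqP; rewrite eqn_leq n1.
  by case: nHx; move: xn; rewrite n_1 expg1 => ->; apply: subgroup1.
set p := pdiv n; have p_pr : prime p by apply: pdiv_prime.
have [i [j [def_x xi xj]]] := pi_decomp p n0 xn.
have [Hi|nHi] := pselect (H (x ^+ i)); last first.
  by exists p, (x ^+ i), (n`_p)%N; split=> //; apply: part_pnat.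
apply: (IHn (n`_p^')%N _ (x ^+ j)) => //.
  rewrite -{2}(partnC p n0) ltn_Pmull // p_part.
  by rewrite -(exp1n (logn p n)) ltn_exp2r ?prime_gt1 // logn_gt0 pi_pdiv.
by move=> Hj; apply: nHx; rewrite def_x; apply: subgroupM.
Qed.

End GenBaer2.

Theorem theorem2p6 (gT : groupType) :
  torsion [set: gT] -> gen_Baer2 [set: gT] ->
  exists (p : nat) (H K : set gT),
    [/\ prime p,
        direct_product H K [set: gT],
        [/\ locally_finite H, p_group p H & gen_Baer2 H],
        Baer2 K
      & forall x : gT, K x -> ~ has_order x p].
Proof.
Local Open Scope group_scope.
move=> tG TG; set G := [set: gT] in tG TG *; set T := T2 G in TG.
have sG : subgroup G by apply: subgroupT.
have sT : subgroup T by apply: gen_subgroup.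
have [g nTg] : exists g, ~ T g.
  apply: contrapT => nT; apply: TG; apply/seteqP; split=> // x _.
  by apply: contrapT => nTx; apply: nT; exists x.
have [n [n0 gn _]] := tG g I.
have [p [y [k [p_pr pk yk nTy]]]] := prime_elt_notin sT n0 gn nTg.
pose H := radical p G; pose K := radical p^' G.
have nG : normal_in G G by split.
have nH : normal_in H G by apply: radical_normal.
have nK : normal_in K G by apply: radical_normal.
have [sH _ _] := nH; have [sK _ _] := nK.
have HK1 x : H x -> K x -> x = 1.
  move=> /radical_pi[m pm xm] /radical_pi[m' pm' xm'].
  exact: pi_expr1 pm pm' xm xm'.
have Hy : H y.
  by apply: (subnormal2_radical pk yk) => //; apply: not_T2_subnormal2.
have split_notin x : ~ T x ->
    exists h b, [/\ x = h * b, H h, K b & subnormal2 (cyc b) G].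
  move=> nTx; have bx := not_T2_subnormal2 nTx.
  have [m [m0 xm _]] := tG x I.
  have [i [j [def_x xi xj]]] := pi_decomp p m0 xm.
  have bX l : subnormal2 (cyc (x ^+ l)) G by apply: subnormal2_cycX xm bx.
  exists (x ^+ i), (x ^+ j); split=> //.
    by apply: subnormal2_radical xi _; rewrite ?part_pnat.
  by apply: subnormal2_radical xj _; rewrite ?part_pnat.
have split_all x : exists h b, [/\ x = h * b, H h, K b & subnormal2 (cyc b) G].
  have [Tx|] := pselect (T x); last exact: split_notin.
  (* Multiplying by y leads out of T, and y^-1 is then absorbed into H. *)
  have [|h [b [def_yx Hh Kb bb]]] := split_notin (y * x).
    move=> Tyx; apply: nTy; rewrite -(mulgK x y).
    exact: subgroupM sT Tyx (subgroupV sT Tx).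
  exists (y^-1 * h), b; split=> //; first by rewrite -mulgA -def_yx mulKg.
  exact: subgroupM sH (subgroupV sH Hy) Hh.
have goodK x : K x -> subnormal2 (cyc x) G.
  move=> Kx; have [h [b [def_x Hh Kb bb]]] := split_all x.
  suff h1 : h = 1 by rewrite def_x h1 mul1g.
  apply: HK1 => //; rewrite -(mulgK b h) -def_x.
  exact: subgroupM sK Kx (subgroupV sK Kb).
exists p, H, K; split=> //.
- split=> //; last first.
    apply/seteqP; split=> // x _; have [h [b [-> Hh Kb _]]] := split_all x.
    by exists h => //; exists b.
  apply/seteqP; split=> [x [Hx Kx]|_ ->]; first exact: HK1.
  by split; apply: subgroup1.
- split; first exact: radical_locally_finite.
    move=> x /radical_pi[m pm xm]; have [r pr ordr] := pi_has_order pm xm.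
    by exists (logn p r); move: ordr; rewrite -p_part part_pnat_id.
  move=> TH; apply: nTy; have: T2 H y by rewrite TH.
  apply: smallest_sub => // x [Hx nx]; apply: sub_gen; split=> // bx; apply: nx.
  apply: subnormal2_restrict => //.
  by apply: smallest_sub => // _ ->.
- move=> x Kx; apply: subnormal2_restrict; [exact: sK| |exact: goodK].
  by apply: smallest_sub => // _ ->.
move=> x Kx [p0 xp ordp].
have [m pm xm] := radical_pi Kx.
have x1 : x = 1.
  by apply: (pi_expr1 _ pm xp xm); rewrite pnat_id.
by apply: (ordp 1%N); rewrite ?prime_gt1 // x1 expg1.
Qed.
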